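(* Let $A$ be a symmetric $n\times n$ matrix with nonnegative entries such that $A^TA$ is irreducible. Then for any real $r\ge2$, $$M_r(A)=\|A\|_{r\to r^*},$$ where $r^*=r/(r-1)$ is the Hölder conjugate of $r$.
   Context: $M_r(A):=\sup_{x\in\mathbb R^n:\|x\|_r\le1}x^TAx$ (the $\ell_r$ Grothendieck, or $\ell_r$ quadratic maximization, problem), and $\|A\|_{r\to p}:=\sup_{x\in\mathbb R^n:\|x\|_r\le1}\|Ax\|_p$, where $\|x\|_q=(\sum_i|x_i|^q)^{1/q}$. *)

(* Defs.v *)
From HB Require Import structures.
From mathcomp Require Import all_boot all_order all_algebra all_fingroup.
From mathcomp Require Import all_classical all_reals all_analysis.
Set Implicit Arguments.
Unset Strict Implicit.
Unset Printing Implicit Defensive.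
Import Order.TTheory GRing.Theory Num.Theory.
Local Open Scope classical_set_scope.
Local Open Scope ring_scope.

Definition lp_norm (R : realType) (n : nat) (q : R) (x : 'cV[R]_n) : R :=
  (\sum_(i < n) `|x i 0| `^ q) `^ q^-1.

(* The suprema are taken in [\bar R], where every set has a supremum, because
   the supremum in [R] of an unbounded set is the default value 0. *)
Definition lr_grothendieck (R : realType) (n : nat) (r : R) (A : 'M[R]_n) :
    \bar R :=
  ereal_sup
    [set ((x^T *m A *m x) 0 0)%:E | x in [set x : 'cV[R]_n | lp_norm r x <= 1]].

Definition op_norm (R : realType) (m n : nat) (r p : R) (A : 'M[R]_(m, n)) :
    \bar R :=
  ereal_sup
    [set (lp_norm p (A *m x))%:E | x in [set x : 'cV[R]_n | lp_norm r x <= 1]].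

(* [B] is reducible when P *m B *m P^T has the block form
     / B1 B2 \
     \ 0  B3 /
   for some permutation matrix P, with diagonal blocks of sizes k and n - k,
   both positive. In particular every 1 x 1 matrix is irreducible. *)
Definition reducible_mx (R : realType) (n : nat) (B : 'M[R]_n) : Prop :=
  exists (s : 'S_n) (k : nat),
    [/\ (0 < k)%N, (k < n)%N &
        forall i j : 'I_n, (k <= i)%N -> (j < k)%N ->
          (perm_mx s *m B *m (perm_mx s)^T) i j = 0].

Definition irreducible_mx (R : realType) (n : nat) (B : 'M[R]_n) : Prop :=
  ~ reducible_mx B.

(* Main.v *)
Require Import Defs.
From HB Require Import structures.
From mathcomp Require Import all_boot all_order all_algebra all_fingroup.
From mathcomp Require Import all_classical all_reals all_analysis.
From mathcomp Require Import ring lra.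
Set Implicit Arguments.
Unset Strict Implicit.
Unset Printing Implicit Defensive.
Import Order.TTheory GRing.Theory Num.Theory.
Local Open Scope ring_scope.

(** By duality between the r-norm and the r*-norm, the norm of A from r to r*
    is the supremum of the bilinear form y^T A x over pairs of vectors in the
    unit ball of the r-norm, so M_r(A) is the same supremum restricted to the
    diagonal x = y. Hence M_r(A) is at most the operator norm
    ([sum_mul_le_lp_norm], Hölder's inequality).

    For the converse, a pair (x, y) has to be replaced by a single vector at
    which the form is at least as large. As A has nonnegative entries, x and y
    may be taken nonnegative. Let z_i be the r-power mean of x_i and y_i. The
    sum of the z_i^r is the average of those of the x_i^r and of the y_i^r, so
    z stays in the unit ball. Power means increase with the exponent and
    r >= 2, so z_i is at least the quadratic mean of x_i and y_i, and the
    Cauchy-Schwarz inequality in the plane gives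
      z_i z_j >= (x_i y_j + y_i x_j) / 2
    ([pmean_mul_ge]). Multiplying by A_ij, summing, and using the symmetry of A
    yields z^T A z >= y^T A x ([bilinear_le_quadratic_pmean]). *)

(** * Hölder duality for finite vectors *)

Lemma lp_norm_ge0 (R : realType) (n : nat) (q : R) (x : 'cV[R]_n) :
  0 <= lp_norm q x.
Proof. exact: powR_ge0. Qed.

Lemma lp_norm_powR (R : realType) (n : nat) (q : R) (x : 'cV[R]_n) :
  q != 0 -> lp_norm q x `^ q = \sum_(i < n) `|x i 0| `^ q.
Proof.
move=> q0; rewrite /lp_norm -powRrM mulVf// powRr1//.
by apply: sumr_ge0 => i _; exact: powR_ge0.
Qed.

Lemma lp_norm_le1 (R : realType) (n : nat) (q : R) (x : 'cV[R]_n) :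
  0 < q -> (lp_norm q x <= 1) = (\sum_(i < n) `|x i 0| `^ q <= 1).
Proof.
move=> q0; have pow1 t : 1 `^ t = 1 :> R by rewrite powR1.
apply/idP/idP => le1.
  rewrite -lp_norm_powR ?gt_eqF// -[leRHS](pow1 q).
  by apply: ge0_ler_powR; rewrite ?nnegrE ?lp_norm_ge0// ltW.
rewrite -[leRHS](pow1 q^-1); apply: ge0_ler_powR le1.
- by rewrite invr_ge0 ltW.
- by rewrite nnegrE; apply: sumr_ge0 => i _; exact: powR_ge0.
- by rewrite nnegrE.
Qed.

Lemma lp_norm0 (R : realType) (n : nat) (q : R) :
  0 < q -> lp_norm q (0 : 'cV[R]_n) = 0.
Proof.
move=> q0; rewrite /lp_norm big1 ?powR0 ?invr_eq0 ?gt_eqF// => i _.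
by rewrite mxE normr0 powR0 ?gt_eqF.
Qed.

Lemma lp_norm_eq0 (R : realType) (n : nat) (q : R) (x : 'cV[R]_n) :
  0 < q -> lp_norm q x = 0 -> x = 0.
Proof.
move=> q0 x0; have := lp_norm_powR x (lt0r_neq0 q0).
rewrite x0 powR0 ?gt_eqF// => /esym/eqP.
rewrite psumr_eq0 => [/allP sum0|i _]; last exact: powR_ge0.
apply/matrixP => i j; rewrite ord1 mxE.
have := sum0 i (mem_index_enum i) => /implyP/(_ isT).
by rewrite powR_eq0 normr_eq0 => /andP[/eqP].
Qed.

Lemma sum_powR_normalized (R : realType) (n : nat) (q : R) (w : 'cV[R]_n) :
  0 < q -> 0 < lp_norm q w ->
  \sum_(i < n) (`|w i 0| / lp_norm q w) `^ q = 1.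
Proof.
move=> q0 N0; under eq_bigr => i _.
  rewrite powRM ?invr_ge0 ?lp_norm_ge0// -powR_inv1 ?lp_norm_ge0// powRAC.
  over.
rewrite -mulr_suml -lp_norm_powR ?gt_eqF// powR_inv1 ?powR_ge0//.
by rewrite mulfV// gt_eqF// powR_gt0.
Qed.

(** Hölder's inequality, obtained by summing Young's inequality for the entries
    of [x] and of [w] scaled to norm 1. *)
Lemma sum_mul_le_lp_norm (R : realType) (n : nat) (p q : R)
    (x w : 'cV[R]_n) :
  0 < p -> 0 < q -> p^-1 + q^-1 = 1 -> lp_norm p x <= 1 ->
  \sum_(i < n) `|x i 0| * `|w i 0| <= lp_norm q w.
Proof.
move=> p0 q0 pq; rewrite lp_norm_le1// => x1.
have [N0|N0] := eqVneq (lp_norm q w) 0.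
  rewrite N0 (lp_norm_eq0 q0 N0) big1// => i _.
  by rewrite mxE normr0 mulr0.
have Ngt0 : 0 < lp_norm q w by rewrite lt_def N0 lp_norm_ge0.
rewrite -[leRHS]mul1r -ler_pdivrMr// mulr_suml.
apply: (@le_trans _ _ (\sum_(i < n) (`|x i 0| `^ p / p
    + (`|w i 0| / lp_norm q w) `^ q / q))).
  apply: ler_sum => i _; rewrite -mulrA; apply: conjugate_powR => //.
  by rewrite divr_ge0 ?lp_norm_ge0.
rewrite big_split/= -!mulr_suml sum_powR_normalized// -[leRHS]pq mul1r.
by rewrite lerD2r ler_piMl// invr_ge0 ltW.
Qed.

(** The extremal vector in Hölder's inequality has entries proportional to
    [`|w i 0| `^ (q - 1)]; its p-th powers sum to 1 because [(q - 1) * p = q]. *)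
Lemma lp_norm_attained (R : realType) (n : nat) (p q : R) (w : 'cV[R]_n) :
  0 < p -> 0 < q -> p^-1 + q^-1 = 1 ->
  exists y : 'cV[R]_n,
    [/\ lp_norm p y <= 1, forall i, 0 <= y i 0 &
        \sum_(i < n) y i 0 * `|w i 0| = lp_norm q w].
Proof.
move=> p0 q0 pq.
have [N0|N0] := eqVneq (lp_norm q w) 0.
  exists 0; split=> [|i|]; rewrite ?lp_norm0 ?mxE//.
  by rewrite N0 big1// => i _; rewrite mxE mul0r.
have Ngt0 : 0 < lp_norm q w by rewrite lt_def N0 lp_norm_ge0.
have Eq : (q - 1) * p = q.
  have -> : q - 1 = q * p^-1.
    by rewrite -[p^-1](addrK q^-1) pq mulrBr mulr1 mulfV// gt_eqF.
  by rewrite divfK// gt_eqF.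
pose u i := `|w i 0| / lp_norm q w.
have u0 i : 0 <= u i by rewrite divr_ge0 ?lp_norm_ge0.
exists (\col_i u i `^ (q - 1)); split=> [|i|].
- rewrite lp_norm_le1//; under eq_bigr => i _.
    rewrite mxE ger0_norm ?powR_ge0// -powRrM Eq; over.
  by rewrite sum_powR_normalized.
- by rewrite mxE powR_ge0.
- transitivity (\sum_(i < n) lp_norm q w * (u i `^ q)).
    apply: eq_bigr => i _; rewrite mxE -(mulr_powRB1 (u0 i) q0) mulrA.
    by rewrite [X in _ = X * _]mulrC divfK// mulrC.
  by rewrite -mulr_sumr sum_powR_normalized// mulr1.
Qed.

(** * Replacing a pair of vectors by their power mean *)

Definition pmean (R : realType) (r a b : R) : R :=
  ((a `^ r + b `^ r) / 2) `^ r^-1.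

Lemma pmean_ge0 (R : realType) (r a b : R) : 0 <= pmean r a b.
Proof. exact: powR_ge0. Qed.

Lemma pmean_powR (R : realType) (r a b : R) :
  r != 0 -> pmean r a b `^ r = (a `^ r + b `^ r) / 2.
Proof.
move=> r0; rewrite /pmean -powRrM mulVf// powRr1//.
by rewrite divr_ge0// addr_ge0 ?powR_ge0.
Qed.

(** Convexity of [fun t => t `^ (r / 2)], applied to the squares. *)
Lemma quadratic_mean_le_pmean (R : realType) (r a b : R) :
  2 <= r -> 0 <= a -> 0 <= b ->
  (a ^+ 2 + b ^+ 2) / 2 <= pmean r a b ^+ 2.
Proof.
move=> r2 a0 b0.
have r0 : 0 < r by lra.
have sqK c : 0 <= c -> (c ^+ 2) `^ (r / 2) = c `^ r.
  by move=> c0; rewrite -powR_mulrn// -powRrM mulrCA mulfV// mulr1.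
have S0 : 0 <= (a ^+ 2 + b ^+ 2) / 2 by rewrite divr_ge0// addr_ge0 ?sqr_ge0.
have cvx : ((a ^+ 2 + b ^+ 2) / 2) `^ (r / 2) <= (a `^ r + b `^ r) / 2.
  have h1 : 0 <= 2^-1 :> R by rewrite invr_ge0.
  have h2 : 2^-1 <= 1 :> R by rewrite invf_le1 ?ler1n.
  have r1 : 1 <= r / 2 by lra.
  have ge0 c : c ^+ 2 \in (`[0, +oo[%classic : set R).
    by rewrite inE/= in_itv/= sqr_ge0.
  have := @convex_powR _ _ r1 (Itv01 h1 h2) _ _ (ge0 a) (ge0 b).
  rewrite [X in X `^ _ <= _ -> _]convRE convRE/= /unstable.onem.
  rewrite (_ : 1 - 2^-1 = 2^-1); last by field.
  by rewrite !sqK// -!mulrDr ![2^-1 * _]mulrC.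
have -> : (a ^+ 2 + b ^+ 2) / 2
    = (((a ^+ 2 + b ^+ 2) / 2) `^ (r / 2)) `^ (r / 2)^-1.
  by rewrite -powRrM mulfV ?powRr1//; lra.
have -> : pmean r a b ^+ 2 = ((a `^ r + b `^ r) / 2) `^ (r / 2)^-1.
  by rewrite -powR_mulrn ?pmean_ge0// /pmean -powRrM invf_div [r^-1 * _]mulrC.
apply: ge0_ler_powR cvx; rewrite ?nnegrE ?powR_ge0//.
  by rewrite invr_ge0; lra.
by rewrite divr_ge0// addr_ge0 ?powR_ge0.
Qed.

(** The power means are at least the quadratic means, and for these the bound is
    the Cauchy-Schwarz inequality for (a, b) and (d, c). *)
Lemma pmean_mul_ge (R : realType) (r a b c d : R) :
  2 <= r -> 0 <= a -> 0 <= b -> 0 <= c -> 0 <= d ->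
  (a * d + b * c) / 2 <= pmean r a b * pmean r c d.
Proof.
move=> r2 a0 b0 c0 d0.
rewrite -(@ler_pXn2r _ 2)// ?nnegrE; last 2 first.
- by rewrite divr_ge0// addr_ge0 ?mulr_ge0.
- by rewrite mulr_ge0 ?pmean_ge0.
rewrite [leRHS]exprMn.
apply: (@le_trans _ _ ((a ^+ 2 + b ^+ 2) / 2 * ((c ^+ 2 + d ^+ 2) / 2))).
  (* Lagrange's identity: the difference is the square of (a c - b d) / 2. *)
  rewrite -subr_ge0.
  rewrite (_ : _ - _ = ((a * c - b * d) / 2) ^+ 2) ?sqr_ge0//.
  by field.
apply: ler_pM; rewrite ?quadratic_mean_le_pmean//;
  by rewrite divr_ge0// addr_ge0 ?sqr_ge0.
Qed.

Definition pmean_col (R : realType) (n : nat) (r : R) (x y : 'cV[R]_n) :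
    'cV[R]_n :=
  \col_i pmean r (x i 0) (y i 0).

Lemma bilinear_formE (R : realType) (n : nat) (A : 'M[R]_n) (x y : 'cV[R]_n) :
  (y^T *m A *m x) 0 0 = \sum_(i < n) \sum_(j < n) A i j * (y i 0 * x j 0).
Proof.
rewrite -mulmxA mxE; apply: eq_bigr => i _; rewrite !mxE mulr_sumr.
by apply: eq_bigr => j _; rewrite mulrCA.
Qed.

(** Symmetry of [A] turns the bilinear form into the average of its values at
    (y, x) and (x, y), which [pmean_mul_ge] bounds entry by entry. *)
Lemma bilinear_le_quadratic_pmean (R : realType) (n : nat) (A : 'M[R]_n)
    (r : R) (x y : 'cV[R]_n) :
  A^T = A -> (forall i j, 0 <= A i j) -> 2 <= r ->
  (forall i, 0 <= x i 0) -> (forall i, 0 <= y i 0) ->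
  (y^T *m A *m x) 0 0 <= ((pmean_col r x y)^T *m A *m pmean_col r x y) 0 0.
Proof.
move=> A_sym A0 r2 x0 y0.
have -> : (y^T *m A *m x) 0 0 = \sum_(i < n) \sum_(j < n)
    A i j * ((x i 0 * y j 0 + y i 0 * x j 0) / 2).
  have swap : (y^T *m A *m x) 0 0 = (x^T *m A *m y) 0 0.
    rewrite -[in RHS]A_sym -trmx_mul -[in RHS](trmxK y) -trmx_mul.
    by rewrite [RHS]mxE mulmxA.
  transitivity (((x^T *m A *m y) 0 0 + (y^T *m A *m x) 0 0) / 2).
    by rewrite -swap; field.
  rewrite !bilinear_formE -big_split/= mulr_suml; apply: eq_bigr => i _.
  rewrite -big_split/= mulr_suml; apply: eq_bigr => j _.
  by rewrite -mulrDr mulrA.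
rewrite bilinear_formE; apply: ler_sum => i _; apply: ler_sum => j _.
by rewrite !mxE ler_wpM2l// pmean_mul_ge.
Qed.

Lemma lp_norm_pmean_le1 (R : realType) (n : nat) (r : R) (x y : 'cV[R]_n) :
  0 < r -> (forall i, 0 <= x i 0) -> (forall i, 0 <= y i 0) ->
  lp_norm r x <= 1 -> lp_norm r y <= 1 -> lp_norm r (pmean_col r x y) <= 1.
Proof.
move=> r0 x0 y0; rewrite !lp_norm_le1// => x1 y1; under eq_bigr => i _.
  rewrite mxE ger0_norm ?pmean_ge0// pmean_powR ?gt_eqF//.
  rewrite -[x i 0]ger0_norm// -[y i 0]ger0_norm//; over.
by rewrite -mulr_suml big_split/=; lra.
Qed.

(** * The two inequalities between the suprema *)

Lemma quadratic_le_lp_norm (R : realType) (n : nat) (p q : R) (A : 'M[R]_n)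
    (x : 'cV[R]_n) :
  0 < p -> 0 < q -> p^-1 + q^-1 = 1 -> lp_norm p x <= 1 ->
  (x^T *m A *m x) 0 0 <= lp_norm q (A *m x).
Proof.
move=> p0 q0 pq x1.
apply: le_trans (sum_mul_le_lp_norm (A *m x) p0 q0 pq x1).
rewrite -mulmxA mxE; apply: ler_sum => i _.
by rewrite mxE -normrM ler_norm.
Qed.

(** The vector [z] is the power mean of [|x|] and of the vector dual to
    [A *m x]: the latter pairs with [|A *m x|] to the norm, and [|A *m x|] is
    entrywise at most [A *m |x|] because [A] has nonnegative entries. *)
Lemma lp_norm_le_quadratic (R : realType) (n : nat) (r q : R) (A : 'M[R]_n)
    (x : 'cV[R]_n) :
  A^T = A -> (forall i j, 0 <= A i j) -> 2 <= r -> 0 < q ->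
  r^-1 + q^-1 = 1 -> lp_norm r x <= 1 ->
  exists2 z : 'cV[R]_n, lp_norm r z <= 1 &
    lp_norm q (A *m x) <= (z^T *m A *m z) 0 0.
Proof.
move=> A_sym A0 r2 q0 rq x1; have r0 : 0 < r by lra.
have [y [y1 y0 <-]] := lp_norm_attained (A *m x) r0 q0 rq.
pose x' : 'cV[R]_n := \col_i `|x i 0|.
have x'0 i : 0 <= x' i 0 by rewrite mxE.
have x'1 : lp_norm r x' <= 1.
  rewrite /lp_norm; under eq_bigr => i _ do rewrite mxE normr_id.
  exact: x1.
exists (pmean_col r x' y); first exact: lp_norm_pmean_le1.
apply: le_trans (bilinear_le_quadratic_pmean A_sym A0 r2 x'0 y0).
rewrite -mulmxA [leRHS]mxE; apply: ler_sum => i _; rewrite [_^T _ _]mxE.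
rewrite ler_wpM2l// mxE [leRHS]mxE; apply: le_trans (ler_norm_sum _ _ _) _.
by apply: ler_sum => j _; rewrite mxE normrM (ger0_norm (A0 i j)).
Qed.

Theorem proposition2p13 (R : realType) (n : nat) (A : 'M[R]_n)
    (A_sym : A^T = A)
    (A_ge0 : forall i j : 'I_n, 0 <= A i j)
    (AtA_irr : irreducible_mx (A^T *m A))
    (r : R) (r_ge2 : 2 <= r) :
  lr_grothendieck r A = op_norm r (r / (r - 1)) A.
Proof.
have r0 : 0 < r by lra.
have q0 : 0 < r / (r - 1) by rewrite divr_gt0//; lra.
have rq : r^-1 + (r / (r - 1))^-1 = 1.
  by rewrite invf_div mulrBl mul1r mulfV ?gt_eqF// addrC subrK.
apply/eqP; rewrite eq_le; apply/andP; split; apply: ge_ereal_sup => _ [x x1 <-].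
  apply: (@le_trans _ _ (lp_norm (r / (r - 1)) (A *m x))%:E).
    by rewrite lee_fin; exact: (quadratic_le_lp_norm A r0 q0 rq x1).
  by apply: ereal_sup_ubound; exists x.
have [z z1 le_z] :=
  lp_norm_le_quadratic A_sym A_ge0 r_ge2 q0 rq x1.
apply: (@le_trans _ _ ((z^T *m A *m z) 0 0)%:E); first by rewrite lee_fin.
by apply: ereal_sup_ubound; exists z.
Qed.
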